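(* For every integer $k\ge1$, the Hausdorff dimension of the graph $\{(x,f_k(x)):x\in[0,1]\}\subset\mathbb{R}^2$ of $f_k$ is $1$.
   Context: Let $E\subset\mathbb{R}^3$ be the set of $(b,u,v)$ with $0<b<1$, $b-1<u<\frac1b-1$, $-b<v<\frac{b}{1-b}$, and such that $(1+v)(1-b(1+u))^2<1-b$ or $(b+v)^2<b(1+u)(1+v)^2$. Fix an open interval $I\ni 0$ and a smooth ($C^\infty$) curve $t\mapsto(b_1(t),c_0(t),c_1(t))\in E$, $t\in I$. For $A=\begin{pmatrix}a&b\\c&d\end{pmatrix}$ put $\Phi(A;z)=\frac{az+b}{cz+d}$, and let $$A_0(t)=\begin{pmatrix}b_1(t)(1+c_0(t))&0\\c_0(t)&1\end{pmatrix},\quad A_1(t)=\begin{pmatrix}1-b_1(t)+c_1(t)&b_1(t)\\c_1(t)&1\end{pmatrix}.$$ For $t\in I$, $F(t,\cdot)$ is the unique continuous $f:[0,1]\to[0,1]$ with $f(x)=\Phi(A_0(t);f(2x))$ for $0\le x\le\frac12$ and $f(x)=\Phi(A_1(t);f(2x-1))$ for $\frac12\le x\le1$; it is strictly increasing with $F(t,0)=0$, $F(t,1)=1$. Define $f_k(x)=\partial_t^kF(0,x)$ for $x\in[0,1]$, $k\ge0$ (these derivatives exist and $f_k$ is continuous). *)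

(* Defs.v *)
From HB Require Import structures.
From mathcomp Require Import all_boot all_order all_algebra.
From mathcomp Require Import all_classical all_reals all_analysis.

Set Implicit Arguments.
Unset Strict Implicit.
Unset Printing Implicit Defensive.

Import Order.TTheory GRing.Theory Num.Theory.
Import numFieldNormedType.Exports.

Local Open Scope classical_set_scope.
Local Open Scope ring_scope.

Section Hausdorff.
Variable R : realType.
Implicit Types (U A : set (R * R)) (s delta : R).

(* The norm that the library puts on [R * R] is the sup norm, hence the
   explicit Euclidean distance. *)
Definition edist (p q : R * R) : R :=
  Num.sqrt ((p.1 - q.1) ^+ 2 + (p.2 - q.2) ^+ 2).

(* The maximum with 0 only matters for the empty set. *)
Definition diam U : \bar R :=
  maxe 0%E (ereal_sup [set (edist pq.1 pq.2)%:E | pq in U `*` U]).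

(* [0 `^ 0 = 1], so that for [s = 0] nonempty sets have weight 1, but the empty
   set (which pads finite covers into sequences) must have weight 0. *)
Definition diam_pow s U : \bar R :=
  if U == set0 then 0%E else (diam U `^ s)%E.

Definition delta_cover delta A : set (nat -> set (R * R)) :=
  [set U | A `<=` \bigcup_i U i /\ forall i, (diam (U i) <= delta%:E)%E].

Definition hausdorff_premeasure s delta A : \bar R :=
  ereal_inf [set (\sum_(0 <= i <oo) diam_pow s (U i))%E
            | U in delta_cover delta A].

(* The premeasure is nonincreasing in [delta], so this supremum is its limit
   as [delta] tends to 0. *)
Definition hausdorff_measure s A : \bar R :=
  ereal_sup [set hausdorff_premeasure s delta A
            | delta in [set delta | 0 < delta]].

Definition hausdorff_dim A : \bar R :=
  ereal_inf [set s%:E | s in [set s | 0 <= s /\ hausdorff_measure s A = 0%E]].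

End Hausdorff.

Section DeRham.
Variable R : realType.

Definition mx2 (a b c d : R) : 'M[R]_2 :=
  \matrix_(i, j) if i == 0 then (if j == 0 then a else b)
                 else (if j == 0 then c else d).

Definition Phi (A : 'M[R]_2) (z : R) : R :=
  (A 0 0 * z + A 0 1) / (A 1 0 * z + A 1 1).

Definition matA0 (b u : R) : 'M[R]_2 := mx2 (b * (1 + u)) 0 u 1.

Definition matA1 (b v : R) : 'M[R]_2 := mx2 (1 - b + v) b v 1.

Definition param_region : set (R * R * R) :=
  [set p | let: (b, u, v) := p in
    [/\ 0 < b < 1,
        b - 1 < u < b^-1 - 1,
        - b < v < b / (1 - b) &
        (1 + v) * (1 - b * (1 + u)) ^+ 2 < 1 - b \/
        (b + v) ^+ 2 < b * (1 + u) * (1 + v) ^+ 2]].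

Definition deRham_solution (A0 A1 : 'M[R]_2) (f : R -> R) : Prop :=
  [/\ {within `[0, 1], continuous f},
      forall x : R, 0 <= x <= 1 -> 0 <= f x <= 1,
      forall x : R, 0 <= x <= 2^-1 -> f x = Phi A0 (f (2 * x)) &
      forall x : R, 2^-1 <= x <= 1 -> f x = Phi A1 (f (2 * x - 1))].

(* Meant for open [I]: the derivatives are two-sided. *)
Definition smooth_on (I : set R) (g : R -> R) : Prop :=
  forall n t, I t -> derivable (derive1n n g) t 1.

Definition graph01 (f : R -> R) : set (R * R) :=
  [set (x, f x) | x in `[0, 1]].

End DeRham.

(* Main.v *)
(** Write [x] in binary; after [n] digits, [F t x] lies in the interval
    [Phi_w([0,1])], where [w] is the word of these digits. In the basis (0,1), (1,1) of the
    cone 0 <= x <= y the two matrices have nonnegative entries, so left endpoint and length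
    of this interval are built from sums of products of at most [2n] positive smooth
    functions of [t]. Differentiating such an expression [j] times costs a factor
    O(n^j) relative to the expression itself, hence the [k]-th derivative of the length of
    the interval of [w] is at most O(n^k) times this length. The lengths decay
    geometrically with the length of [w], uniformly in [t] near 0; so the oscillation of
    [f_k] on the dyadic interval of [w] is at most O(theta^n) times the length of
    [Phi_w([0,1])], for any [theta > 1]. The lengths sum to 1 over the words of length [n],
    and covering the graph by the pieces over the dyadic intervals gives
    [s]-dimensional measure 0 for [s > 1]. For [s < 1], projecting a cover to the
    horizontal axis contradicts that [0,1] has Lebesgue measure 1. *)
Require Import Defs.
From HB Require Import structures.
From mathcomp Require Import all_boot all_order all_algebra.
From mathcomp Require Import all_classical all_reals all_analysis.
From mathcomp Require Import ring lra.

Set Implicit Arguments.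
Unset Strict Implicit.
Unset Printing Implicit Defensive.

Import Order.TTheory GRing.Theory Num.Theory.
Import numFieldNormedType.Exports.

Local Open Scope classical_set_scope.
Local Open Scope ring_scope.

(** * Limits of derivatives *)

Section Calculus.
Variables (R : realType) (V : set R) (openV : open V).
Implicit Types (f g : R -> R) (t : R).

Lemma is_derive_eq_on f g t (d : R) : V t -> {in V, f =1 g} ->
  is_derive t 1 f d -> is_derive t 1 g d.
Proof.
move=> Vt fg; apply: near_eq_is_derive.
near=> s; apply: fg; rewrite inE; near: s; exact: open_nbhs_nbhs.
Unshelve. all: by end_near. Qed.

Lemma derive1_eq_on f g : {in V, f =1 g} -> {in V, derive1 f =1 derive1 g}.
Proof.
move=> fg t /[!inE] Vt; rewrite !derive1E.
apply: near_eq_derive.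
near=> s; apply: fg; rewrite inE; near: s; exact: open_nbhs_nbhs.
Unshelve. all: by end_near. Qed.

Lemma derive1n_eq_on n f g :
  {in V, f =1 g} -> {in V, derive1n n f =1 derive1n n g}.
Proof.
by move=> fg; elim: n => // n IH; rewrite !derive1nS; exact: derive1_eq_on.
Qed.

Lemma derive1nSr n f : derive1n n.+1 f = derive1n n (derive1 f).
Proof. by rewrite /derive1n iterSr. Qed.

(** The telescoping series is dominated by a geometric one. The estimate is stated at index 0; tails
    are reached by shifting the sequence. *)
Lemma cvg_geometric_increments (x : nat -> R) (C r : R) :
  0 <= r < 1 -> (forall n, `|x n.+1 - x n| <= C * r ^+ n) ->
  cvgn x /\ `|x 0%N - limn x| <= C / (1 - r).
Proof.
move=> /andP[r0 r1] xC.
have C0 : 0 <= C by have := xC 0%N; rewrite expr0 mulr1; apply: le_trans.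
have rn : `|r| < 1 by rewrite ger0_norm.
have gC := @is_cvg_geometric_series _ C r rn.
have cx : cvgn (series (telescope x)).
  apply: normed_cvg; apply: series_le_cvg gC => //= n.
  by rewrite mulr_ge0 // exprn_ge0.
have {}cx : cvgn x.
  have -> : x = (fun n => x 0%N + series (telescope x) n).
    by apply/funext => n; exact: eq_sum_telescope.
  by apply: is_cvgD => //; exact: is_cvg_cst.
split=> //.
have xb n : `|x 0%N - x n| <= C / (1 - r).
  rewrite distrC; have -> : x n - x 0%N = series (telescope x) n.
    by rewrite seriesEnat /= telescope_sumr.
  rewrite seriesEnat /=; apply: (le_trans (ler_norm_sum _ _ _)).
  apply: (@le_trans _ _ (series (geometric C r) n)).
    by rewrite seriesEnat /=; apply: ler_sum => i _; exact: xC.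
  rewrite geometric_seriesE ?lt_eqF //= -mulrA ler_wpM2l // ler_pdivrMr ?subr_gt0 //.
  by rewrite mulVf ?subr_eq0 ?gt_eqF // gerBl exprn_ge0.
have cl : `|x 0%N - x n| @[n --> \oo] --> `|x 0%N - limn x|.
  by apply: cvg_norm; apply: cvgB cx; exact: cvg_cst.
rewrite -(cvg_lim _ cl) //; apply: limr_le; first by apply/cvg_ex; eexists; exact: cl.
by near=> n; exact: xb.
Unshelve. all: by end_near. Qed.

Lemma ler_increment_ball f (df : R -> R) t (d B : R) :
  (forall z, ball t d z -> is_derive z 1 f (df z)) ->
  (forall z, ball t d z -> `|df z| <= B) ->
  forall x y, ball t d x -> ball t d y -> `|f y - f x| <= B * `|y - x|.
Proof.
move=> fdf dfB x y.
wlog xy : x y / x <= y => [hw tx ty|tx ty].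
  by case: (leP x y) => [|/ltW] xy; [|rewrite distrC [in leRHS]distrC]; exact: hw.
have tz z : z \in `[x, y]%R -> ball t d z.
  move: tx ty; rewrite /ball/= in_itv/= !ltr_distlC => /andP[tx1 tx2] /andP[ty1 ty2] /andP[xz zy].
  by rewrite (lt_le_trans tx1 xz) (le_lt_trans zy ty2).
have [|z|c cxy ->] := @MVT_segment _ f df x y xy.
- move=> z zxy; apply/fdf/tz; exact: subset_itv_oo_cc.
- apply: (@derivable_within_continuous _ _ _ `[x, y]%R) => w wxy.
  by have [] := fdf _ (tz _ wxy).
- by rewrite normrM ler_wpM2r //; apply: dfB; exact: tz.
Qed.

(** Uniform convergence of the derivatives: for [m >= N] the mean value theorem compares the
    increments of [P m] and [P N] uniformly in [m], so the comparison survives the limit in [m]. The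
    difference quotient of the single function [P N] is then close to [D N t], hence to [g t]. *)
Lemma is_derive_lim (P D : nat -> R -> R) (f g : R -> R) (e : nat -> R) :
  (forall n t, V t -> is_derive t 1 (P n) (D n t)) ->
  (forall t, V t -> P ^~ t @ \oo --> f t) ->
  (forall n t, V t -> `|D n t - g t| <= e n) ->
  e @ \oo --> 0 ->
  forall t, V t -> is_derive t 1 f (g t).
Proof.
move=> PD Pf Dg e0 t Vt.
suff H : (fun h => h^-1 *: ((f \o shift t) (h *: 1) - f t)) @ 0^' --> g t.
  by split; [apply/cvg_ex; eexists; exact: H | exact: cvg_lim H].
have /nbhs_ballP[d /= d0 dV] := open_nbhs_nbhs (conj openV Vt).
apply/cvgrPdist_lt => eps eps0.
have e40 : 0 < eps / 4 by rewrite divr_gt0.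
have e_small : \forall n \near \oo, e n <= eps / 4.
  move/cvgrPdist_le : e0 => /(_ _ e40); apply: filterS => n.
  by rewrite sub0r normrN; apply: le_trans; exact: ler_norm.
have [N _ eN] := e_small.
have eN4 : e N <= eps / 4 by apply: eN => /=.
have [dP vP] := PD N t Vt.
have PNt : (fun h => h^-1 *: ((P N \o shift t) (h *: 1) - P N t)) @ 0^' --> D N t.
  by move: dP => /cvg_ex[l Pl]; rewrite -vP; move: (Pl); rewrite -(cvg_lim _ Pl).
move/cvgrPdist_lt : PNt => /(_ _ e40) PNt.
near=> h.
have h0 : h != 0 by near: h; exact: nbhs_dnbhs_neq.
have th : ball t d (h + t).
  rewrite /ball /= opprD addrCA subrr addr0 normrN.
  by near: h; exact: dnbhs0_lt.
rewrite /= [h *: 1]mulr1.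
(* Both [D m] and [D N] are within eps/4 of [g], so the derivative of [P m - P N] is at most
   eps/2. *)
have key m : (N <= m)%N ->
    `|(P m (h + t) - P m t) - (P N (h + t) - P N t)| <= eps / 2 * `|h|.
  move=> Nm; have dPmN z : ball t d z ->
      is_derive z 1 (P m - P N) (D m z - D N z).
    by move=> /dV Vz; apply: is_deriveB; exact: PD.
  have -> : (P m (h + t) - P m t) - (P N (h + t) - P N t) =
      (P m - P N) (h + t) - (P m - P N) t by rewrite !fctE; ring.
  have -> : `|h| = `|h + t - t| by rewrite addrK.
  apply: (ler_increment_ball dPmN _ (ballxx t d0)) => // z.
  move=> /dV Vz; rewrite (_ : D m z - D N z = (D m z - g z) - (D N z - g z)); last by ring.
  apply: (le_trans (ler_normB _ _)); rewrite (_ : eps / 2 = eps / 4 + eps / 4); last by field.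
  by apply: lerD; apply: (le_trans (Dg _ _ Vz)) => //; exact: eN.
have kf : `|(f (h + t) - f t) - (P N (h + t) - P N t)| <= eps / 2 * `|h|.
  have cf : `|(P m (h + t) - P m t) - (P N (h + t) - P N t)| @[m --> \oo] -->
      `|(f (h + t) - f t) - (P N (h + t) - P N t)|.
    apply: cvg_norm; apply: cvgB; last exact: cvg_cst.
    by apply: cvgB; apply: Pf => //; exact: dV.
  rewrite -(cvg_lim _ cf) //; apply: limr_le; first by apply/cvg_ex; eexists; exact: cf.
  by near=> m; apply: key; near: m; exact: nbhs_infty_ge.
have {}kf : `|h^-1 * (f (h + t) - f t) - h^-1 * (P N (h + t) - P N t)| <= eps / 2.
  by rewrite -mulrBr normrM normfV mulrC ler_pdivrMr // normr_gt0.
have kP : `|D N t - h^-1 * (P N (h + t) - P N t)| < eps / 4.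
  by have := near PNt h; rewrite /= [h *: 1]mulr1; apply.
have := Dg N t Vt.
move: kf kP eN4; rewrite /GRing.scale /=.
set a := h^-1 * _; set b := h^-1 * _ => kf kP eN4 kD.
rewrite (_ : g t - a = (D N t - b) - (D N t - g t) - (a - b)); last by ring.
apply: (le_lt_trans (ler_normB _ _)).
apply: (@lt_le_trans _ _ (eps / 4 + eps / 4 + eps / 2)); last first.
  by rewrite le_eqVlt; apply/orP; left; apply/eqP; field.
rewrite ltr_leD //; apply: (le_lt_trans (ler_normB _ _)).
by rewrite ltr_leD // (le_trans kD).
Unshelve. all: by end_near. Qed.

(** Induction on [k], peeling off the innermost derivative: on [V] the derivative of [f] is the
    limit of the derivatives of [P n], a sequence satisfying the same hypotheses with [k] lowered by
    one. *)
Lemma derive1n_lim (k : nat) (P : nat -> R -> R) (f : R -> R) (C r : R) :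
  0 <= r < 1 ->
  (forall n j t, (j < k)%N -> V t -> derivable (derive1n j (P n)) t 1) ->
  (forall n j t, (j <= k)%N -> V t ->
     `|derive1n j (P n.+1) t - derive1n j (P n) t| <= C * r ^+ n) ->
  (forall t, V t -> P ^~ t @ \oo --> f t) ->
  forall t, V t -> (fun n => derive1n k (P n) t) @ \oo --> derive1n k f t.
Proof.
move=> r01; elim: k P f => [|k IH] P f dP PC Pf t Vt; first exact: Pf.
pose D n : R -> R := derive1 (P n); pose g t : R := limn (D ^~ t).
have Dg n s : V s -> cvgn (D ^~ s) /\ `|D n s - g s| <= C * r ^+ n / (1 - r).
  move=> Vs.
  (* Starting the sequence at [n] yields the distance to the limit at index [n], uniformly in
     [s]. *)
  have incr m : `|D (m.+1 + n)%N s - D (m + n)%N s| <= C * r ^+ n * r ^+ m.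
    by rewrite -mulrA -exprD [(n + m)%N]addnC addSn; apply: (PC _ 1%N).
  have [/cvg_ex[lim_D cD] D_lim] := cvg_geometric_increments r01 incr.
  have {}cD : D ^~ s @ \oo --> lim_D.
    by rewrite -(cvg_shiftn n (D ^~ s)); exact: cD.
  split; first by apply/cvg_ex; exists lim_D.
  have -> : g s = limn (fun m => D (m + n)%N s); last exact: D_lim.
  have h1 := cvg_lim (@Rhausdorff R) cD.
  have := cD; rewrite -(cvg_shiftn n (D ^~ s)) => /(cvg_lim (@Rhausdorff R)) h2.
  by rewrite h2; exact: h1.
have fg : {in V, derive1 f =1 g}.
  move=> s /[!inE] Vs; rewrite derive1E.
  have PD n u : V u -> is_derive u 1 (P n) (D n u).
    move=> Vu; rewrite /D derive1E.
    by have /derivableP := dP n 0%N u isT Vu.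
  have DG n u : V u -> `|D n u - g u| <= C * r ^+ n / (1 - r) by move=> Vu; have [] := Dg n u Vu.
  have e0 : (fun n => C * r ^+ n / (1 - r)) @ \oo --> 0.
    rewrite -[X in _ --> X](mul0r (1 - r)^-1); apply: cvgMr_tmp.
    by apply: (@cvg_geometric R C r); case/andP: r01 => r0 r1; rewrite ger0_norm.
  by have [] := is_derive_lim PD Pf DG e0 Vs.
rewrite derive1nSr (derive1n_eq_on k fg) ?inE //.
under eq_fun do rewrite derive1nSr.
apply: (IH D g) => //.
- by move=> n j s jk Vs; rewrite -derive1nSr; exact: dP.
- by move=> n j s jk Vs; rewrite -!derive1nSr; exact: PC.
- by move=> s Vs; have [] := Dg 0%N s Vs.
Qed.

End Calculus.
(** * Functions whose derivatives are controlled by a majorant *)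

Section Tame.
Variables (R : realType) (V : set R).
Implicit Types (f g F G : R -> R).

(* [|f^(j)| <= l ^ j * F] on [V] for [j <= k]; the derivatives are existential so that
   sums and products need no locality argument. *)
Fixpoint tame k (l : R) f F : Prop :=
  (forall t, V t -> `|f t| <= F t) /\
  if k is k'.+1 then
    exists2 f', forall t, V t -> is_derive t 1 f (f' t)
              & tame k' l f' (fun t => l * F t)
  else True.

Lemma tame_le k l m f F G : 0 <= l <= m ->
  (forall t, V t -> F t <= G t) -> tame k l f F -> tame k m f G.
Proof.
move=> /andP[l0 lm]; elim: k f F G => [|k IH] f F G FG [fF].
  by move=> _; split=> // t Vt; exact: le_trans (fF _ Vt) (FG _ Vt).
move=> [f' ff' T]; split=> [t Vt|]; first exact: le_trans (fF _ Vt) (FG _ Vt).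
exists f' => //; apply: IH T => t Vt.
have F0 : 0 <= F t := le_trans (normr_ge0 _) (fF _ Vt).
by apply: ler_pM => //; exact: FG.
Qed.

Lemma tameS k l f F : tame k.+1 l f F -> tame k l f F.
Proof.
elim: k f F => [|k IH] f F [fF [f' ff' T]]; split=> //.
by exists f' => //; exact: IH.
Qed.

Lemma tameD k l f F g G :
  tame k l f F -> tame k l g G -> tame k l (fun t => f t + g t) (fun t => F t + G t).
Proof.
elim: k f F g G => [|k IH] f F g G [fF Tf] [gG Tg]; (split=> [t Vt|]; first by
  apply: (le_trans (ler_normD _ _)); apply: lerD; [exact: fF|exact: gG]) => //.
case: Tf Tg => f' ff' Tf [g' gg' Tg].
exists (fun t => f' t + g' t) => [t Vt|]; first exact: is_deriveD (ff' _ Vt) (gg' _ Vt).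
have -> : (fun t => l * (F t + G t)) = (fun t => l * F t + l * G t).
  by apply/funext => t; rewrite mulrDr.
exact: IH.
Qed.

(** Rates add because [(l + m) * (F * G)] splits into [F * (m * G)] and [(l * F) * G], the majorants
    of the two terms of the product rule. *)
Lemma tameM k l m f F g G : 0 <= l -> 0 <= m ->
  tame k l f F -> tame k m g G ->
  tame k (l + m) (fun t => f t * g t) (fun t => F t * G t).
Proof.
move=> l0 m0.
elim: k f F g G => [|k IH] f F g G; first (move=> [fF Tf] [gG Tg];
  split=> // t Vt; rewrite normrM; by apply: ler_pM; [| |exact: fF|exact: gG]).
move=> Tf0 Tg0; have Tf1 := tameS Tf0; have Tg1 := tameS Tg0.
case: Tf0 Tg0 => fF [f' ff' Tf] [gG [g' gg' Tg]].
split=> [t Vt|].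
  by rewrite normrM; apply: ler_pM; [| |exact: fF|exact: gG].
exists (fun t => f t * g' t + f' t * g t) => [t Vt|].
  apply: is_derive_eq; first exact: is_deriveM (ff' _ Vt) (gg' _ Vt).
  by rewrite /GRing.scale /= [g t * _]mulrC.
have -> : (fun t => (l + m) * (F t * G t)) =
    (fun t => F t * (m * G t) + (l * F t) * G t).
  by apply/funext => t; ring.
by apply: tameD; exact: IH.
Qed.

Lemma tameN k l f F : tame k l f F -> tame k l (fun t => - f t) F.
Proof.
elim: k f F => [|k IH] f F [fF Tf]; (split=> [t Vt|]; first by
  rewrite normrN; exact: fF) => //.
case: Tf => f' ff' Tf; exists (fun t => - f' t) => [t Vt|]; last exact: IH.
exact: is_deriveN (ff' _ Vt).
Qed.

Lemma tame_cst k l (c : R) : 0 <= l -> tame k l (fun=> c) (fun=> `|c|).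
Proof.
(* Any majorant [d >= |c|] must be allowed: after one derivative the constant is 0 while the
   majorant is [l * d]. *)
move=> l0; suff H : forall k (c d : R), `|c| <= d -> tame k l (fun=> c) (fun=> d) by exact: H.
elim=> [|j IH] {}c d cd; split=> //; exists (fun=> 0) => [t Vt|].
  exact: is_derive_cst.
by apply: IH; rewrite normr0 mulr_ge0 // (le_trans _ cd).
Qed.

(* The rate [c_k l] of [1 / f] satisfies [c_(k+1) = 1 + 2 c_k], from
   [(1 / f)' = - f' * (1 / f)^2]. *)
Lemma tameV k l f : 0 <= l -> (forall t, V t -> 0 < f t) ->
  tame k l f f -> tame k ((2 ^+ k.+1 - 1) * l) (fun t => (f t)^-1) (fun t => (f t)^-1).
Proof.
move=> l0 f0; elim: k => [|k IH] Tf.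
  by split=> // t Vt; rewrite ger0_norm // invr_ge0; exact/ltW/f0.
have {IH} Tg := IH (tameS Tf).
case: Tf => _ [f' ff' Tf]; split=> [t Vt|].
  by rewrite ger0_norm // invr_ge0; exact/ltW/f0.
have c1 : 1 <= 2 ^+ k.+1 :> R by rewrite exprn_ege1 // ler1n.
set c := 2 ^+ k.+1 - 1 in Tg.
have c0 : 0 <= c by rewrite /c subr_ge0.
exists (fun t => - (f' t * ((f t)^-1 * (f t)^-1))) => [t Vt|].
  apply: is_derive_eq; first by apply: is_deriveV (ff' _ Vt); apply/lt0r_neq0/f0.
  by rewrite /GRing.scale /= mulNr expr2 invfM mulrC.
have -> : 2 ^+ k.+2 - 1 = 1 + c + c by rewrite /c [2 ^+ k.+2]exprS; ring.
have T : tame k (l + (c * l + c * l)) (fun t => f' t * ((f t)^-1 * (f t)^-1))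
    (fun t => l * f t * ((f t)^-1 * (f t)^-1)).
  apply: tameM => //; first by rewrite addr_ge0 ?mulr_ge0.
  by apply: tameM => //; rewrite mulr_ge0.
apply: tameN; apply: tame_le T.
  by rewrite !addr_ge0 ?mulr_ge0 //= !mulrDl mul1r !addrA.
move=> t Vt; have ft := f0 _ Vt.
rewrite (_ : l * f t * _ = l * (f t)^-1); last by field; rewrite gt_eqF.
rewrite ler_wpM2r ?invr_ge0 ?(ltW ft) //.
by rewrite -[leLHS]mul1r ler_wpM2r // -addrA lerDl addr_ge0.
Qed.

Hypothesis openV : open V.

Lemma tame_eq_on k l f g F : {in V, f =1 g} -> tame k l f F -> tame k l g F.
Proof.
move=> fg; case: k => [|k] [fF Tf]; (split=> [t Vt|]; first by
  rewrite -fg ?inE //; exact: fF) => //.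
case: Tf => f' ff' Tf; exists f' => // t Vt.
by apply: (is_derive_eq_on openV Vt fg); exact: ff'.
Qed.

(** Together with [derive1n_tame], this identifies the derivatives chosen in [tame] with the
    iterated ones, [V] being open. *)
Lemma tame_derive1n k l f F : tame k l f F -> forall t, V t ->
  (forall j, (j < k)%N -> derivable (derive1n j f) t 1) /\
  (forall j, (j <= k)%N -> `|derive1n j f t| <= l ^+ j * F t).
Proof.
elim: k f F => [|k IH] f F [fF Tf] t Vt.
  by split=> // -[|//] _; rewrite expr0 mul1r; exact: fF.
case: Tf => f' ff' Tf.
have f'E : {in V, f' =1 derive1 f}.
  by move=> s /[!inE] Vs; rewrite derive1E; have [_ <-] := ff' _ Vs.
have [IH1 IH2] := IH _ _ (tame_eq_on f'E Tf) t Vt.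
split=> -[|j] jk; rewrite ?derive1nSr.
- by have [] := ff' _ Vt.
- exact: IH1.
- by rewrite expr0 mul1r; exact: fF.
- by rewrite exprSr -mulrA; exact: IH2.
Qed.

Lemma derive1n_tame k l f F :
  (forall t j, V t -> (j < k)%N -> derivable (derive1n j f) t 1) ->
  (forall t j, V t -> (j <= k)%N -> `|derive1n j f t| <= l ^+ j * F t) ->
  tame k l f F.
Proof.
elim: k f F => [|k IH] f F df bf; (split=> [t Vt|]; first by
  have := bf t 0%N Vt isT; rewrite expr0 mul1r) => //.
exists (derive1 f) => [t Vt|].
  by rewrite derive1E; apply/derivableP; exact: (df t 0%N).
apply: IH => t j Vt jk; rewrite -derive1nSr; first exact: df.
by rewrite mulrA -exprSr; exact: bf.
Qed.

Lemma tame_derive1 k l f F : tame k.+1 l f F ->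
  (forall t, V t -> derivable f t 1) /\ tame k l (derive1 f) (fun t => l * F t).
Proof.
move=> [_ [f' ff' Tf]]; split=> [t Vt|]; first by have [] := ff' _ Vt.
apply: tame_eq_on Tf => s /[!inE] Vs.
by rewrite derive1E; have [_ <-] := ff' _ Vs.
Qed.

Lemma tame_derive1nB k l m f F g G t : tame k l f F -> tame k m g G -> V t ->
  derive1n k (fun s => f s - g s) t = derive1n k f t - derive1n k g t.
Proof.
elim: k f F g G => // k IH f F g G /tame_derive1[df Tf] /tame_derive1[dg Tg] Vt.
rewrite !derive1nSr -(IH _ _ _ _ Tf Tg Vt).
apply: (derive1n_eq_on openV); last by rewrite inE.
by move=> s /[!inE] Vs; rewrite !derive1E deriveB; [|exact: df|exact: dg].
Qed.

Lemma tame_leq j k l f F : (j <= k)%N -> tame k l f F -> tame j l f F.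
Proof.
elim: k => [|k IH]; first by rewrite leqn0 => /eqP ->.
by rewrite leq_eqVlt => /orP[/eqP -> //|/IH H /tameS /H].
Qed.

End Tame.
(** * The intervals [Phi_w([0,1])] *)

Section Words.
Variable R : realType.
Implicit Types (b u v z x M : R) (w : seq bool).

(* Words are written with the newest digit at the head. With [A_w] the product of the
   matrices of the digits of [w], oldest digit first, [wt] lists the second coordinates of
   [A_w (0,1)] and [A_w (1,1)] and [wdet] is [\det A_w]; [Phi_w([0,1])] starts at [wleft]
   and has length [wlen]; [wmap] is [Phi_w]. *)
Fixpoint wt b u v w : R * R :=
  if w is i :: w' then
    let s := wt b u v w' in let X := (1 - b) * s.1 + b * s.2 in
    if i then (X, (1 + v) * s.2) else (s.1, (1 + u) * X)
  else (1, 1).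

Fixpoint wdet b u v w : R :=
  if w is i :: w' then
    wdet b u v w' * (if i then (1 - b) * (1 + v) else b * (1 + u))
  else 1.

Definition wlen b u v w : R :=
  wdet b u v w * ((wt b u v w).1^-1 * (wt b u v w).2^-1).

(** The right child starts where the left one ends. The endpoint is thus a sum of lengths, and its
    derivatives are controlled by theirs. *)
Fixpoint wleft b u v w : R :=
  if w is i :: w' then
    wleft b u v w' + (if i then wlen b u v (false :: w') else 0)
  else 0.

(** [Phi_w z - Phi_w 0] is the determinant times [z] over the product of the denominators of [Phi_w]
    at 0 and at [z], the latter being affine in [z]; [wlen] is the case [z = 1]. *)
Definition wmap b u v w z : R :=
  let s := wt b u v w in
  wleft b u v w + wdet b u v w * z / (s.1 * ((1 - z) * s.1 + z * s.2)).

(* With [(p, q) = wt b u v w], these inequalities propagate [q <= M p] and [p <= M q] from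
   [w] to [i :: w]. *)
Record tempered M b u v : Prop := Tempered {
  tempered_b : 0 < b < 1;
  tempered_u : 0 < 1 + u;
  tempered_v : 0 < 1 + v;
  tempered_M : 1 <= M;
  tempered_b1 : 1 <= M * (1 - b);
  tempered_0 : 1 <= M * ((1 + u) * (1 - b));
  tempered_00 : (1 + u) * (1 - b) <= M * (1 - b * (1 + u));
  tempered_1 : 1 + v <= M * b;
  tempered_11 : b <= M * (b + v) }.

(** The largest value of [x / (x + y)] for positive [x], [y] with [x <= M ^+ 2 * y]. *)
Definition contraction M : R := M ^+ 2 / (1 + M ^+ 2).

(** The lower bound 1/2 lets the powers of [contraction M] dominate the widths of the dyadic
    intervals. *)
Lemma contraction_itv M : 1 <= M -> 2^-1 <= contraction M < 1.
Proof.
move=> M1; have M2 : 1 <= M ^+ 2 by rewrite exprn_ege1.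
by rewrite /contraction ler_pdivlMr ?ltr_pdivrMr; lra.
Qed.

(** * Binary digits and the doubling map *)

Definition dig x : bool := 2^-1 <= x.
(** The digit of 1/2 is 1 and [dbl] fixes 1, so the closed interval [0,1] is mapped into itself. *)
Definition dbl x : R := 2 * x - (dig x)%:R.
Fixpoint word n x : seq bool :=
  if n is n'.+1 then dig (iter n' dbl x) :: word n' x else [::].

Lemma size_word n x : size (word n x) = n.
Proof. by elim: n => //= n ->. Qed.

Lemma dbl_itv x : 0 <= x <= 1 -> 0 <= dbl x <= 1.
Proof. by rewrite /dbl /dig; case: (leP 2^-1 x) => /= h; lra. Qed.

Lemma iter_dbl_itv n x : 0 <= x <= 1 -> 0 <= iter n dbl x <= 1.
Proof. by move=> x01; elim: n => //= n; exact: dbl_itv. Qed.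

Lemma word_eq_dist n x y : word n x = word n y ->
  x - y = 2^-1 ^+ n * (iter n dbl x - iter n dbl y).
Proof.
elim: n => [|n IH] /=; first by rewrite expr0 mul1r.
by case=> dxy /IH ->; rewrite /dbl dxy exprSr; field.
Qed.

Lemma word_eq_close n x y : 0 <= x <= 1 -> 0 <= y <= 1 ->
  word n x = word n y -> `|x - y| <= 2^-1 ^+ n.
Proof.
move=> /(iter_dbl_itv n) x01 /(iter_dbl_itv n) y01 /word_eq_dist ->.
rewrite normrM ger0_norm ?exprn_ge0 // ler_piMr ?exprn_ge0 //.
by rewrite ler_norml; lra.
Qed.

Fixpoint words n : seq (seq bool) :=
  if n is n'.+1 then map (cons false) (words n') ++ map (cons true) (words n')
  else [:: [::]].

Lemma mem_words n x : word n x \in words n.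
Proof.
elim: n => //= n IH; rewrite mem_cat.
by case: (dig _); rewrite (map_f (cons _) IH) ?orbT.
Qed.

Lemma size_words n w : w \in words n -> size w = n.
Proof.
elim: n w => [w|n IH w] /=; first by rewrite inE => /eqP ->.
by rewrite mem_cat => /orP[] /mapP[w' /IH <- ->].
Qed.

Lemma count_words n : size (words n) = (2 ^ n)%N.
Proof. by elim: n => //= n IH; rewrite size_cat !size_map IH expnS mul2n addnn. Qed.

(** * Lengths and maps of words at a fixed parameter *)

Section Fixed.
Variables (M b u v : R) (Mbuv : tempered M b u v).

Let b0 : 0 < b. Proof. by have [/andP[]] := Mbuv. Qed.
Let b1 : 0 < 1 - b. Proof. by have [/andP[]] := Mbuv; lra. Qed.
Let u0 : 0 < 1 + u. Proof. by have [] := Mbuv. Qed.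
Let v0 : 0 < 1 + v. Proof. by have [] := Mbuv. Qed.
Let M1 : 1 <= M. Proof. by have [] := Mbuv. Qed.

Let X0 (p q : R) : 0 < p -> 0 < q -> 0 < (1 - b) * p + b * q.
Proof. by move=> p0 q0; rewrite addr_gt0 ?mulr_gt0. Qed.

Let conv_gt0 (z p q : R) : 0 <= z <= 1 -> 0 < p -> 0 < q -> 0 < (1 - z) * p + z * q.
Proof.
move=> /andP[z0 z1] p0 q0; case: (ltP 0 z) => [zp|z0'].
  by rewrite ltr_wpDl ?mulr_gt0 // mulr_ge0 ?subr_ge0 // ltW.
have -> : z = 0 by apply/eqP; rewrite eq_le z0 z0'.
by rewrite subr0 mul1r mul0r addr0.
Qed.

Lemma wt_gt0 w : 0 < (wt b u v w).1 /\ 0 < (wt b u v w).2.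
Proof.
elim: w => [|[] w [p0 q0]] /=; first by split.
  by split; [exact: X0|exact: mulr_gt0].
by split=> //; apply: mulr_gt0 => //; exact: X0.
Qed.

(** Both bounds are carried together. For each digit, one follows by dropping a term of the convex
    combination ([tempered_1], [tempered_0]), the other by inserting the induction hypothesis
    ([tempered_11], [tempered_00]). *)
Lemma wt_ratio w : (wt b u v w).2 <= M * (wt b u v w).1 /\
  (wt b u v w).1 <= M * (wt b u v w).2.
Proof.
have [_ _ _ _ h1 h2 h3 h4 h5] := Mbuv.
elim: w => [|i w [qp pq]] /=; first by rewrite mulr1.
have [p0 q0] := wt_gt0 w; set p := (wt _ _ _ _).1 in p0 qp pq *.
set q := (wt _ _ _ _).2 in q0 qp pq *.
case: i => /=; split.
- rewrite (@le_trans _ _ (M * b * q)) ?ler_pM2r //.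
  by rewrite -mulrA ler_wpM2l ?(le_trans ler01) // lerDr mulr_ge0 // ltW.
- rewrite (@le_trans _ _ ((1 - b) * (M * q) + M * (b + v) * q)) //; last by lra.
  by apply: lerD; [rewrite ler_pM2l|rewrite ler_pM2r].
- rewrite (@le_trans _ _ ((1 + u) * (1 - b) * p + b * (1 + u) * (M * p))) //.
    rewrite mulrDr !mulrA lerD2l [b * _]mulrC -!mulrA !ler_pM2l //.
  rewrite (@le_trans _ _ (M * (1 - b * (1 + u)) * p + b * (1 + u) * (M * p))) //.
    by rewrite lerD2r ler_pM2r.
  by lra.
- rewrite (@le_trans _ _ (M * ((1 + u) * (1 - b)) * p)) //.
    by rewrite ler_peMl // ltW.
  rewrite -!mulrA ler_wpM2l ?(le_trans ler01) // ler_pM2l // lerDl.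
  by rewrite mulr_ge0 // ltW.
Qed.

Lemma wdet_gt0 w : 0 < wdet b u v w.
Proof. by elim: w => [|[] w IH] //=; rewrite !mulr_gt0. Qed.

Lemma wlen_gt0 w : 0 < wlen b u v w.
Proof.
by have [p0 q0] := wt_gt0 w; rewrite mulr_gt0 ?wdet_gt0 // mulr_gt0 ?invr_gt0.
Qed.

(** With [(p, q)] the weights of [w] and [X = (1 - b) * p + b * q], the children receive the shares
    [b * q / X] and [(1 - b) * p / X] of the parent. *)
Lemma wlen_split w :
  wlen b u v (false :: w) + wlen b u v (true :: w) = wlen b u v w.
Proof.
have [p0 q0] := wt_gt0 w; have := X0 p0 q0; rewrite /wlen /=.
by move=> Xw; field; rewrite !gt_eqF.
Qed.

(** In each share the two terms of the denominator have ratio at most [M ^+ 2]: one factor [M] comes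
    from [b] against [1 - b], the other from [wt_ratio]. *)
Lemma wlen_cons_le i w : wlen b u v (i :: w) <= contraction M * wlen b u v w.
Proof.
have [_ _ _ _ h1 h2 h3 h4 h5] := Mbuv.
have [p0 q0] := wt_gt0 w; have Xw := X0 p0 q0; have [qp pq] := wt_ratio w.
have D0 := wdet_gt0 w; rewrite /wlen /=.
set p := (wt _ _ _ _).1 in p0 qp pq Xw *; set q := (wt _ _ _ _).2 in q0 qp pq Xw *.
set D := wdet _ _ _ _ in D0 *; set X := (_ * p + _) in Xw *.
have M2 : 0 < 1 + M ^+ 2 by rewrite ltr_wpDr ?sqr_ge0.
have b1' : b <= M * (1 - b) by have := b1; lra.
(* [tempered_11] forces [b + v > 0], whence [1 - b < 1 + v <= M * b]. *)
have b1'' : 1 - b <= M * b.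
  have : 0 < M * (b + v) by rewrite (lt_le_trans b0).
  have M0 : 0 < M by exact: lt_le_trans M1.
  by rewrite (pmulr_rgt0 _ M0) => bv; lra.
case: i => /=.
- have -> : D * ((1 - b) * (1 + v)) * (X^-1 * ((1 + v) * q)^-1) = D / (p * q) * ((1 - b) * p / X).
    by field; rewrite !gt_eqF.
  have -> : contraction M * (D * (p^-1 * q^-1)) = D / (p * q) * contraction M.
    by field; rewrite !gt_eqF.
  rewrite ler_pM2l ?divr_gt0 ?mulr_gt0 // ler_pdivrMr // /contraction mulrAC.
  rewrite ler_pdivlMr // /X.
  suff : (1 - b) * p <= M * b * (M * q) by lra.
  by apply: ler_pM => //; apply: ltW; rewrite // mulr_gt0.
- have -> : D * (b * (1 + u)) * (p^-1 * ((1 + u) * X)^-1) = D / (p * q) * (b * q / X).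
    by field; rewrite !gt_eqF.
  have -> : contraction M * (D * (p^-1 * q^-1)) = D / (p * q) * contraction M.
    by field; rewrite !gt_eqF.
  rewrite ler_pM2l ?divr_gt0 ?mulr_gt0 // ler_pdivrMr // /contraction mulrAC.
  rewrite ler_pdivlMr // /X.
  suff : b * q <= M * (1 - b) * (M * p) by lra.
  by apply: ler_pM => //; apply: ltW; rewrite // mulr_gt0.
Qed.

Lemma wlen_le w : wlen b u v w <= contraction M ^+ size w.
Proof.
have /andP[c0 _] := contraction_itv M1.
elim: w => [|i w IH]; first by rewrite /wlen /= !invr1 !mulr1.
by apply: (le_trans (wlen_cons_le _ _)); rewrite /= exprS ler_wpM2l // (le_trans _ c0).
Qed.

Lemma sum_wlen n : \sum_(w <- words n) wlen b u v w = 1.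
Proof.
elim: n => [|n IH] /=; first by rewrite big_seq1 /wlen /= !invr1 !mulr1.
rewrite big_cat /= !big_map -big_split /= -[RHS]IH.
by apply: eq_bigr => w _; exact: wlen_split.
Qed.

(** The newest digit acts innermost. The denominator [u * z + 1] is a convex combination of 1 and
    [1 + u], hence positive. *)
Lemma wmap_Phi0 w z : 0 <= z <= 1 ->
  wmap b u v w (Phi (matA0 b u) z) = wmap b u v (false :: w) z.
Proof.
move=> z01; rewrite /wmap /Phi /matA0 !mxE /=.
have [p0 q0] := wt_gt0 w; have Xw := X0 p0 q0.
set p := (wt _ _ _ _).1 in p0 Xw *; set q := (wt _ _ _ _).2 in q0 Xw *.
have uz : 0 < u * z + 1 by have := conv_gt0 z01 ltr01 u0; lra.
have Y0 : 0 < (1 - z) * p + z * ((1 + u) * ((1 - b) * p + b * q)).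
  by apply: conv_gt0 => //; exact: mulr_gt0.
rewrite !addr0; congr (_ + _) => //.
have uz' := lt0r_neq0 uz; have Y0' := lt0r_neq0 Y0; have p0' := lt0r_neq0 p0.
by clearbody p q; field; rewrite ?uz' ?p0' ?Y0'.
Qed.

Lemma wmap_Phi1 w z : 0 <= z <= 1 ->
  wmap b u v w (Phi (matA1 b v) z) = wmap b u v (true :: w) z.
Proof.
move=> z01; rewrite /wmap /Phi /matA1 !mxE /= /wlen /=.
have [p0 q0] := wt_gt0 w; have Xw := X0 p0 q0.
set p := (wt _ _ _ _).1 in p0 Xw *; set q := (wt _ _ _ _).2 in q0 Xw *.
have vz : 0 < v * z + 1 by have := conv_gt0 z01 ltr01 v0; lra.
have Y0 : 0 < (1 - z) * ((1 - b) * p + b * q) + z * ((1 + v) * q).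
  by apply: conv_gt0 => //; exact: mulr_gt0.
rewrite -[RHS]addrA; congr (_ + _) => //.
have vz' := lt0r_neq0 vz; have Y0' := lt0r_neq0 Y0; have p0' := lt0r_neq0 p0.
have X' := lt0r_neq0 Xw; have u0' := lt0r_neq0 u0.
by clearbody p q; field; rewrite ?vz' ?p0' ?X' ?u0' ?Y0'.
Qed.

Lemma wmap_itv w z : 0 <= z <= 1 ->
  `|wmap b u v w z - wleft b u v w| <= wlen b u v w.
Proof.
move=> z01; rewrite /wmap addrAC subrr add0r /wlen.
have [p0 q0] := wt_gt0 w; have D0 := wdet_gt0 w.
set p := (wt _ _ _ _).1 in p0 *; set q := (wt _ _ _ _).2 in q0 *.
have Y0 := conv_gt0 z01 p0 q0; have /andP[z0 z1] := z01.
rewrite ger0_norm; last first.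
  by rewrite divr_ge0 ?mulr_ge0 // ?(ltW D0) // ?(ltW p0) // ltW.
rewrite -mulrA ler_pM2l // -invfM ler_pdivrMr ?mulr_gt0 //.
rewrite mulrC ler_pdivlMr ?mulr_gt0 //.
have : 0 <= (1 - z) * p by rewrite mulr_ge0 ?subr_ge0 // ltW.
by rewrite mulrCA ler_pM2l // lerDr.
Qed.

Variables (F : R -> R).
Hypothesis F_sol : deRham_solution (matA0 b u) (matA1 b v) F.

Lemma wmap_word n x : 0 <= x <= 1 ->
  F x = wmap b u v (word n x) (F (iter n dbl x)).
Proof.
have [_ F01 F0 F1] := F_sol.
move=> x01; elim: n => [|n ->] /=.
  by rewrite /wmap /= add0r !mulr1 !mul1r subrK divr1.
have y01 := iter_dbl_itv n x01; set y := iter n dbl x in y01 *.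
have Fy := F01 _ (dbl_itv y01).
move: Fy; rewrite /dbl /dig; case: (leP 2^-1 y) => /= h Fy.
  by rewrite F1 ?wmap_Phi1 //; lra.
by rewrite subr0 in Fy *; rewrite F0 ?wmap_Phi0 //; lra.
Qed.

(** By [wmap_word], [F x] lies in the interval of [word n x], whose length decays geometrically. *)
Lemma wleft_cvg x : 0 <= x <= 1 ->
  (fun n => wleft b u v (word n x)) @ \oo --> F x.
Proof.
have [_ F01 _ _] := F_sol.
move=> x01; have /andP[c0 c1] := contraction_itv M1.
have cn : `|contraction M| < 1 by rewrite ger0_norm // (le_trans _ c0).
apply/cvgrPdist_le => e e0.
have /cvgrPdist_le /(_ _ e0) := @cvg_geometric _ 1 _ cn.
apply: filterS => n; rewrite sub0r normrN /= mul1r => cne.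
rewrite (wmap_word n x01); apply: le_trans cne.
apply: (le_trans (wmap_itv _ _)); first exact/F01/iter_dbl_itv.
by apply: (le_trans (wlen_le _)); rewrite size_word; exact: ler_norm.
Qed.

End Fixed.
End Words.
(* Induction on [k]: pass to the square root of [th] and use Bernoulli's inequality. *)
Lemma natr_exp_geometric (R : realType) (k : nat) (th : R) : 1 < th ->
  exists2 C, 0 <= C & forall n, n.+1%:R ^+ k <= C * th ^+ n.
Proof.
elim: k th => [|k IH] th th1.
  by exists 1 => // n; rewrite expr0 mul1r exprn_ege1 // ltW.
have th0 : 0 < th := lt_trans ltr01 th1.
have s1 : 1 < Num.sqrt th by rewrite -sqrtr1 ltr_sqrt.
have [C C0 Ck] := IH _ s1.
set s := Num.sqrt th in s1 Ck; have ss : th = s * s by rewrite -expr2 sqr_sqrtr // ltW.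
have s10 : 0 < s - 1 by rewrite subr_gt0.
have lin n : n.+1%:R <= (1 + (s - 1)^-1) * s ^+ n.
  have bern : 1 + n%:R * (s - 1) <= s ^+ n.
    elim: n => [|n IHn]; first by rewrite mul0r addr0 expr0.
    rewrite exprS; apply: (@le_trans _ _ (s * (1 + n%:R * (s - 1)))); last first.
      by rewrite ler_pM2l // (lt_trans ltr01).
    have : 0 <= n%:R * (s - 1) * (s - 1) by rewrite !mulr_ge0 // ltW.
    by rewrite -natr1; lra.
  have sn : 1 <= s ^+ n by rewrite exprn_ege1 // ltW.
  have : n%:R <= (s - 1)^-1 * s ^+ n by rewrite mulrC ler_pdivlMr //; lra.
  by rewrite -natr1; lra.
exists ((1 + (s - 1)^-1) * C); first by rewrite mulr_ge0 // addr_ge0 // invr_ge0 ltW.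
move=> n; rewrite exprS ss exprMn mulrACA.
by apply: ler_pM => //; rewrite exprn_ge0.
Qed.

(** * Dependence on the parameter *)

Section WordFunctions.
Variables (R : realType) (V : set R) (openV : open V).
Variables (b u v : R -> R) (M l : R) (k : nat).
Hypothesis Vtemp : forall t, V t -> tempered M (b t) (u t) (v t).
Hypothesis l1 : 1 <= l.
Hypothesis tame_b : tame V k l b b.
Hypothesis tame_b' : tame V k l (fun t => 1 - b t) (fun t => 1 - b t).
Hypothesis tame_u : tame V k l (fun t => 1 + u t) (fun t => 1 + u t).
Hypothesis tame_v : tame V k l (fun t => 1 + v t) (fun t => 1 + v t).

Let wp w t := (wt (b t) (u t) (v t) w).1.
Let wq w t := (wt (b t) (u t) (v t) w).2.
Let wd w t := wdet (b t) (u t) (v t) w.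
Let wl w t := wlen (b t) (u t) (v t) w.
Let wL w t := wleft (b t) (u t) (v t) w.

Let l0 : 0 <= l. Proof. exact: le_trans ler01 l1. Qed.

(** Each digit costs at most two factors among [b], [1 - b], [1 + u], [1 + v], all of rate [l]. *)
Let rate (w : seq bool) : R := (size w)%:R * (l + l).

Let rate_ge0 w : 0 <= rate w.
Proof. by rewrite mulr_ge0 // addr_ge0. Qed.

Let tame_one : tame V k 0 (fun=> 1 : R) (fun=> 1).
Proof. by have := tame_cst V k (1 : R) (lexx 0); rewrite normr1. Qed.

(** The weights are sums of products of positive functions, so no cancellation occurs and each
    weight is its own majorant. *)
Lemma tame_wt w : tame V k (rate w) (wp w) (wp w) /\ tame V k (rate w) (wq w) (wq w).
Proof.
elim: w => [|i w [Tp Tq]]; first by rewrite /rate mul0r; split; exact: tame_one.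
have r1 : rate (i :: w) = l + (l + rate w).
  by rewrite /rate /= -natr1; ring.
have TX : tame V k (l + rate w)
    (fun t => (1 - b t) * wp w t + b t * wq w t)
    (fun t => (1 - b t) * wp w t + b t * wq w t).
  by apply: tameD; apply: tameM; rewrite ?rate_ge0.
have T1 f : tame V k (rate w) f f -> tame V k (rate (i :: w)) f f.
  by apply: tame_le => //; rewrite rate_ge0 r1 addrA lerDr addr_ge0.
case: i r1 T1 => r1 T1; split.
- by apply: tame_le TX => //; rewrite r1 addr_ge0 ?rate_ge0 // lerDr.
- have T : tame V k (l + rate w) (fun t => (1 + v t) * wq w t) (fun t => (1 + v t) * wq w t).
    exact: tameM.
  by apply: tame_le T => //; rewrite r1 addr_ge0 ?rate_ge0 // lerDr.
- exact: T1.
- by rewrite r1; apply: tameM => //; rewrite addr_ge0 ?rate_ge0.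
Qed.

Lemma tame_wdet w : tame V k (rate w) (wd w) (wd w).
Proof.
elim: w => [|i w IH]; first by rewrite /rate mul0r; exact: tame_one.
have -> : rate (i :: w) = rate w + (l + l) by rewrite /rate /= -natr1; ring.
by case: i; (apply: tameM; [exact: rate_ge0|exact: addr_ge0|exact: IH|exact: tameM]).
Qed.

(** [c] is the factor by which inversion raises a rate; [A] is the resulting rate per digit of
    [wlen], made of one determinant and two inverted weights. *)
Let c : R := 2 ^+ k.+1 - 1.
Let A : R := (1 + (c + c)) * (l + l).

Let c0 : 0 <= c.
Proof. by rewrite subr_ge0 exprn_ege1 // ler1n. Qed.

Let A1 : 1 <= A.
Proof.
have h : 1 <= l + l by rewrite (le_trans l1) // lerDl.
by rewrite /A mulr_ege1 // lerDl addr_ge0.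
Qed.

Lemma tame_wlen w : tame V k (A * (size w)%:R) (wl w) (wl w).
Proof.
have [Tp Tq] := tame_wt w.
have -> : A * (size w)%:R = rate w + (c * rate w + c * rate w) by rewrite /A /rate; ring.
have cr : 0 <= c * rate w by rewrite mulr_ge0 ?rate_ge0.
have V_gt0 t : V t -> 0 < wp w t /\ 0 < wq w t by move=> /Vtemp tM; exact: wt_gt0 tM w.
apply: (tameM (rate_ge0 w) (addr_ge0 cr cr) (tame_wdet w)).
by apply: tameM => //; apply: tameV (rate_ge0 w) _ _ => // t /V_gt0[].
Qed.

(** The step is 0 or the length of the left child, which is at most the length of the parent. *)
Lemma tame_wleft_step i w :
  tame V k (A * (size w).+1%:R) (fun t => wL (i :: w) t - wL w t) (wl w).
Proof.
have A0 : 0 <= A := le_trans ler01 A1.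
case: i; last first.
  have -> : (fun t => wL (false :: w) t - wL w t) = (fun=> 0).
    by apply/funext => t; rewrite /wL /= addr0 subrr.
  apply: tame_le (tame_cst V k (0 : R) (lexx 0)); first by rewrite lexx mulr_ge0.
  by move=> t /Vtemp tM; rewrite normr0; exact/ltW/(wlen_gt0 tM).
have -> : (fun t => wL (true :: w) t - wL w t) = wl (false :: w).
  by apply/funext => t; rewrite /wL /= addrAC subrr add0r.
apply: tame_le (tame_wlen (false :: w)); first by rewrite lexx andbT mulr_ge0.
move=> t /Vtemp tM; rewrite /wl -(wlen_split tM w) lerDl.
exact/ltW/(wlen_gt0 tM).
Qed.

(** Any majorant will do: this supplies differentiability, while sizes are read off the steps. *)
Lemma tame_wleft w : exists G, tame V k (A * (size w)%:R) (wL w) G.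
Proof.
have A0 : 0 <= A := le_trans ler01 A1.
elim: w => [|i w [G TG]].
  by exists (fun=> `|0 : R|); rewrite mulr0; exact: tame_cst.
exists (fun t => G t + wl w t).
have -> : wL (i :: w) = (fun t => wL w t + (wL (i :: w) t - wL w t)).
  by apply/funext => t; rewrite addrC subrK.
apply: tameD; last exact: tame_wleft_step.
apply: tame_le TG => //.
by rewrite mulr_ge0 //= ler_wpM2l // ler_nat.
Qed.

Lemma derive1n_wleft_step j i w t : (j <= k)%N -> V t ->
  `|derive1n j (wL (i :: w)) t - derive1n j (wL w) t| <=
  A ^+ k * (size w).+1%:R ^+ k * wl w t.
Proof.
move=> jk Vt; have [[G1 T1] [G0 T0]] := (tame_wleft (i :: w), tame_wleft w).
have -> := esym (tame_derive1nB openV (tame_leq jk T1) (tame_leq jk T0) Vt).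
have [_ /(_ _ jk) h] := tame_derive1n openV (tame_wleft_step i w) Vt.
apply: (le_trans h); rewrite -exprMn ler_wpM2r //; first exact/ltW/(wlen_gt0 (Vtemp Vt)).
(* The base [A * (size w).+1] is at least 1, so the exponent [j] may be raised to [k]. *)
by apply: ler_weXn2l => //; rewrite mulr_ege1 // ler1n.
Qed.

Variables (F : R -> R -> R) (th : R).
Hypothesis F_sol : forall t, V t ->
  deRham_solution (matA0 (b t) (u t)) (matA1 (b t) (v t)) (F t).
Hypothesis th1 : 1 < th.
Hypothesis th_contraction : th * contraction M < 1.

Lemma wlen_word_le m n (x t : R) : V t ->
  wl (word (m + n) x) t <= contraction M ^+ m * wl (word n x) t.
Proof.
move=> /Vtemp tM; elim: m => [|m IH]; first by rewrite add0n expr0 mul1r.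
rewrite addSn /=; apply: (le_trans (wlen_cons_le tM _ _)).
rewrite exprS -mulrA ler_wpM2l //.
have [_ _ _ M1 _ _ _ _ _] := tM.
by have /andP[+ _] := contraction_itv M1; apply: le_trans.
Qed.

(** Points with a common word share its left endpoint. Each derivative of [F] differs from that of
    this endpoint by a sum of later steps, bounded geometrically with ratio [r] and proportional to
    the length of the common word. *)
Lemma derive1n_oscillation : exists2 C, 0 <= C &
  forall n (x y t : R), V t -> 0 <= x <= 1 -> 0 <= y <= 1 -> word n x = word n y ->
  `|derive1n k (F^~ x) t - derive1n k (F^~ y) t| <= C * th ^+ n * wl (word n x) t.
Proof.
have [C C0 Cn] := natr_exp_geometric k th1.
have A0 : 0 <= A := le_trans ler01 A1.
have AC0 : 0 <= A ^+ k * C by rewrite mulr_ge0 // exprn_ge0.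
pose r := th * contraction M.
have rX m : r ^+ m = th ^+ m * contraction M ^+ m by rewrite -exprMn.
have th0 : 0 < th := lt_trans ltr01 th1.
(* Once for [x] and once for [y]. *)
exists ((A ^+ k * C / (1 - r)) *+ 2).
  by rewrite mulrn_wge0 // divr_ge0 // subr_ge0 ltW.
move=> n x y t Vt x01 y01 wxy.
have tM := Vtemp Vt; have [_ _ _ M1 _ _ _ _ _] := tM.
have /andP[cM0 cM1] := contraction_itv M1.
have {}cM0 : 0 <= contraction M by apply: le_trans cM0.
have r01 : 0 <= r < 1 by rewrite [r < 1]th_contraction andbT mulr_ge0 // ltW.
(* The polynomial factor in the word length is absorbed into [C * th ^+ m]. *)
have step j m (z s : R) : (j <= k)%N -> V s ->
    `|derive1n j (wL (word m.+1 z)) s - derive1n j (wL (word m z)) s| <=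
    A ^+ k * C * th ^+ m * wl (word m z) s.
  move=> jk Vs; apply: (le_trans (derive1n_wleft_step _ _ jk Vs)).
  rewrite size_word -!mulrA ler_wpM2l ?exprn_ge0 //.
  by rewrite mulrA ler_wpM2r ?Cn //; exact/ltW/(wlen_gt0 (Vtemp Vs)).
have key z : 0 <= z <= 1 ->
    `|derive1n k (wL (word n z)) t - derive1n k (F^~ z) t| <=
    A ^+ k * C / (1 - r) * th ^+ n * wl (word n z) t.
  move=> z01.
  have cz : (fun m => derive1n k (wL (word m z)) t) @ \oo --> derive1n k (F^~ z) t.
    apply: (@derive1n_lim _ _ openV k (fun m => wL (word m z)) (F^~ z) (A ^+ k * C) r) => //.
    - move=> m j s jk Vs; have [G TG] := tame_wleft (word m z).
      by have [+ _] := tame_derive1n openV TG Vs; apply.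
    - move=> m j s jk Vs; apply: (le_trans (step _ _ _ _ jk Vs)).
      rewrite rX [leRHS]mulrA ler_wpM2l ?mulr_ge0 ?exprn_ge0 ?(ltW th0) //.
      by have := wlen_le (Vtemp Vs) (word m z); rewrite size_word.
    - move=> s Vs; have h := wleft_cvg (Vtemp Vs) (F_sol Vs) z01; exact: h.
  (* Starting at the word of length [n] keeps its length as a factor; only the [m] further digits
     contribute contraction. *)
  have [|_] := @cvg_geometric_increments _ (fun m => derive1n k (wL (word (m + n) z)) t)
      (A ^+ k * C * th ^+ n * wl (word n z) t) r r01.
    move=> m; apply: (le_trans (step _ _ _ _ (leqnn k) Vt)).
    rewrite exprD rX.
    apply: (@le_trans _ _ (A ^+ k * C * (th ^+ m * th ^+ n) *
      (contraction M ^+ m * wl (word n z) t))).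
      by rewrite ler_wpM2l ?wlen_word_le // !mulr_ge0 ?exprn_ge0 ?(ltW th0).
    by rewrite le_eqVlt; apply/orP; left; apply/eqP; ring.
  rewrite add0n (_ : limn _ = derive1n k (F^~ z) t); last first.
    by apply/cvg_lim => //; rewrite (cvg_shiftn n (fun m => derive1n k (wL (word m z)) t)).
  move=> h; apply: (le_trans h).
  by rewrite le_eqVlt; apply/orP; left; apply/eqP; ring.
have := key _ y01; have := key _ x01; rewrite -wxy.
set L := derive1n k (wL _) t; rewrite distrC => kx ky.
rewrite (_ : _ - _ = derive1n k (F^~ x) t - L + (L - derive1n k (F^~ y) t)); last by ring.
apply: (le_trans (ler_normD _ _)); rewrite mulr2n !mulrDl.
exact: lerD.
Qed.

End WordFunctions.
(** * Hausdorff measures *)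

Section HausdorffBounds.
Variable R : realType.
Implicit Types (A U : set (R * R)) (s d : R).

(* The unqualified [edist] is the library's distance on [\bar R]. *)
Lemma edist_le (p q : R * R) : Defs.edist p q <= `|p.1 - q.1| + `|p.2 - q.2|.
Proof.
rewrite /Defs.edist -[leRHS]ger0_norm ?addr_ge0 // -sqrtr_sqr ler_sqrt ?sqr_ge0 //.
rewrite [leRHS]sqrrD !real_normK ?num_real // addrAC lerDl.
by rewrite mulrn_wge0 // mulr_ge0.
Qed.

Lemma edist_ge_fst (p q : R * R) : `|p.1 - q.1| <= Defs.edist p q.
Proof. by rewrite /Defs.edist -sqrtr_sqr ler_sqrt ?addr_ge0 ?sqr_ge0 // lerDl sqr_ge0. Qed.

Lemma diam_le U d : 0 <= d -> (forall p q, U p -> U q -> Defs.edist p q <= d) ->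
  (diam U <= d%:E)%E.
Proof.
move=> d0 Ud; rewrite /diam ge_max lee_fin d0 /=.
by apply: ge_ereal_sup => _ [[p q] [/= Up Uq] <-]; rewrite lee_fin; exact: Ud.
Qed.

Lemma edist_le_diam U p q : U p -> U q -> ((Defs.edist p q)%R%:E <= diam U)%E.
Proof.
move=> Up Uq; rewrite /diam le_max; apply/orP; right.
by apply: ereal_sup_ubound; exists (p, q).
Qed.

Lemma diam_ge0 U : (0 <= diam U)%E.
Proof. by rewrite /diam le_max lexx. Qed.

Lemma diam_pow_ge0 s U : (0 <= diam_pow s U)%E.
Proof. by rewrite /diam_pow; case: ifP => // _; exact: poweR_ge0. Qed.

Lemma diam_pow_le s U d : 0 <= s -> 0 <= d -> (diam U <= d%:E)%E ->
  (diam_pow s U <= (d `^ s)%:E)%E.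
Proof.
move=> s0 d0 Ud; rewrite /diam_pow; case: ifP => [_|_].
  by rewrite lee_fin powR_ge0.
rewrite -poweR_EFin; apply: gt0_ler_poweR => //.
- by rewrite in_itv /= diam_ge0 leey.
- by rewrite in_itv /= lee_fin d0 leey.
Qed.

(** Finite covers with explicit diameter bounds suffice: padding by empty sets adds no weight. *)
Lemma hausdorff_measure_eq0 s A : 0 <= s ->
  (forall e, 0 < e -> exists (l : seq (set (R * R) * R)),
    [/\ A `<=` [set p | exists2 Ud, Ud \in l & Ud.1 p],
        forall Ud, Ud \in l -> 0 <= Ud.2 <= e /\ (diam Ud.1 <= Ud.2%:E)%E &
        \sum_(Ud <- l) Ud.2 `^ s <= e]) ->
  hausdorff_measure s A = 0%E.
Proof.
move=> s0 H; apply/eqP; rewrite eq_le; apply/andP; split; last first.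
  apply: (@le_trans _ _ (hausdorff_premeasure s 1 A)).
    apply: le_ereal_inf_tmp => _ [U _ <-].
    by apply: nneseries_ge0 => i _ _; exact: diam_pow_ge0.
  by apply: ereal_sup_ubound; exists 1 => /=.
apply: ge_ereal_sup => _ [d /= d0 <-].
apply/lee_addgt0Pr => e e0; rewrite add0e.
(* One small number must bound both the diameters, by [d], and the sum, by [e]. *)
have [|l [Al ld le]] := H (Num.min d e); first by rewrite lt_min d0 e0.
pose U i := (nth (set0, 0) l i).1.
have Usmall i : (size l <= i)%N -> U i = set0 by move=> h; rewrite /U nth_default.
have s0' : diam_pow s (@set0 (R * R)) = 0%E by rewrite /diam_pow eqxx.
apply: (@le_trans _ _ (\sum_(0 <= i <oo) diam_pow s (U i))%E).
  apply: ereal_inf_lbound; exists U => //; split.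
    move=> p /Al [Ud Udl Up]; exists (index Ud l) => //.
    by rewrite /U nth_index.
  move=> i; case: (ltnP i (size l)) => il; last first.
    by rewrite Usmall //; apply: diam_le => [|? ? []]; exact: ltW.
  have [/andP[_ h]] := ld _ (mem_nth (set0, 0) il).
  move=> /le_trans; apply; rewrite lee_fin (le_trans h) //.
  by rewrite ge_min lexx.
rewrite (nneseries_split 0 (size l)); last by move=> *; exact: diam_pow_ge0.
rewrite add0n eseries0 ?adde0; last first.
  by move=> i il _; rewrite Usmall.
apply: (@le_trans _ _ (\sum_(Ud <- l) (Ud.2 `^ s)%:E)%E).
  rewrite (big_nth (set0, 0)) big_seq_cond [leRHS]big_seq_cond.
  apply: lee_sum => i /andP[+ _]; rewrite mem_index_iota /= => il.
  by have [/andP[h _] h'] := ld _ (mem_nth (set0, 0) il); exact: diam_pow_le.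
rewrite sumEFin lee_fin (le_trans le) //.
by rewrite ge_min lexx orbT.
Qed.

(** If [s < 1], a cover by sets of diameter [r <= 1] has [r <= r ^ s]; intervals of length [2 * r]
    around the abscissas then cover [0,1] with total length below 1. *)
Lemma hausdorff_measure_graph_gt0 (f : R -> R) s : 0 <= s ->
  hausdorff_measure s (graph01 f) = 0%E -> 1 <= s.
Proof.
move=> s0 H0; rewrite leNgt; apply/negP => s1.
(* With the factor 2 from the intervals, 1/4 makes the total length less than 1/2. *)
have pre0 : (hausdorff_premeasure s 1 (graph01 f) < (4^-1)%:E)%E.
  apply: (@le_lt_trans _ _ 0%E); last by rewrite lte_fin.
  by rewrite -H0; apply: ereal_sup_ubound; exists 1 => /=.
have [_ [U [Ucov Ud] <-] Usum] := ereal_inf_lt pre0.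
pose r i := fine (diam (U i)).
have rE i : diam (U i) = (r i)%:E.
  rewrite fineK // ge0_fin_numE ?diam_ge0 //.
  by apply: le_lt_trans (Ud i) _; rewrite ltey.
have r0 i : 0 <= r i by rewrite -lee_fin -rE diam_ge0.
have r1 i : r i <= 1 by rewrite -lee_fin -rE Ud.
(* Centred at the abscissa of a chosen point of [U i]; an empty [U i] yields an empty set. *)
pose J i : set R := if pselect (U i !=set0) is left h
  then let c := (projT1 (cid h)).1 in `[c - r i, c + r i]%classic else set0.
have mJ i : measurable (J i).
  by rewrite /J; case: pselect => //= h; exact: measurable_itv.
have J01 : `[0%R, 1%R]%classic `<=` \bigcup_i J i.
  move=> x x01; have [|i _ Ui] := Ucov (x, f x); first by exists x.
  exists i => //; rewrite /J; case: pselect => [h|[]]; last by exists (x, f x).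
  case: cid => c Uc /=.
  have := edist_le_diam Ui Uc; rewrite rE lee_fin => /(le_trans (edist_ge_fst _ _)).
  by rewrite in_itv /= ler_norml => /=; lra.
have leJ i : (lebesgue_measure (J i) <= 2%:E * diam_pow s (U i))%E.
  rewrite /J; case: pselect => [h|_]; last first.
    by rewrite measure0 mule_ge0 // diam_pow_ge0.
  rewrite /diam_pow; have -> : (U i == set0) = false.
    by apply/negbTE; apply/set0P.
  rewrite rE poweR_EFin -EFinM /= lebesgue_measure_itv /=.
  case: ifP => _; last by rewrite lee_fin mulr_ge0 // powR_ge0.
  rewrite -EFinB lee_fin (_ : _ - _ = 2 * r i); last by ring.
  rewrite ler_pM2l //; have [->|rn0] := eqVneq (r i) 0; first exact: powR_ge0.
  have ri : 0 < r i <= 1 by rewrite lt_neqAle eq_sym rn0 r0 r1.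
  exact: ger1_powR ri (ltW s1).
have : (lebesgue_measure (`[0%R, 1%R]%classic : set R) <=
    \sum_(0 <= i <oo) lebesgue_measure (J i))%E.
  by apply: measure_sigma_subadditive => //; exact: measurable_itv.
apply/negP; rewrite -ltNge.
apply: (@le_lt_trans _ _ (\sum_(0 <= i <oo) (2%:E * diam_pow s (U i)))%E).
  by apply: lee_nneseries => // i _; exact: leJ.
rewrite nneseriesZl; last by move=> i _; exact: diam_pow_ge0.
rewrite lebesgue_measure_itv /= lte_fin ltr01 oppr0 adde0.
apply: (@lt_trans _ _ (2%:E * (4^-1)%:E)%E).
  by rewrite lte_pmul2l // lte_fin.
by rewrite -EFinM lte_fin; lra.
Qed.

Lemma hausdorff_dim_graph_eq1 (f : R -> R) :
  (forall s, 1 < s -> hausdorff_measure s (graph01 f) = 0%E) ->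
  hausdorff_dim (graph01 f) = 1%E.
Proof.
move=> H; apply/eqP; rewrite eq_le; apply/andP; split.
  apply/lee_addgt0Pr => e e0; apply: ereal_inf_lbound.
  exists (1 + e); last by rewrite EFinD.
  split; first by rewrite addr_ge0 // ltW.
  by apply: H; rewrite ltrDl.
apply: le_ereal_inf_tmp => _ [s [s0 Hs] <-].
by rewrite lee_fin; exact: hausdorff_measure_graph_gt0 Hs.
Qed.

End HausdorffBounds.

(** * Covering a graph by its pieces over dyadic intervals *)

Section UpperBound.
Variable R : realType.

Lemma powR_lt1 (a x : R) : 0 < a < 1 -> 0 < x -> a `^ x < 1.
Proof.
move=> /andP[a0 a1] x0; have <- : 1 `^ x = 1 :> R by rewrite powR1.
by apply: gt0_ltr_powR; rewrite // nnegrE ltW.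
Qed.

Lemma geometric_le (C r e : R) : 0 <= r < 1 -> 0 < e ->
  \forall n \near \oo, C * r ^+ n <= e.
Proof.
move=> /andP[r0 r1] e0; have rn : `|r| < 1 by rewrite ger0_norm.
have /cvgrPdist_le /(_ _ e0) := @cvg_geometric _ C _ rn.
by apply: filterS => n; rewrite sub0r normrN; apply: le_trans; exact: ler_norm.
Qed.

(* [th] is chosen as a small negative power of [rho] such that [th ^ s * rho ^ (s - 1) < 1]. *)
Lemma hausdorff_measure_graph_words (f : R -> R) (s rho : R) (len : seq bool -> R) :
  1 < s -> 2^-1 <= rho < 1 ->
  (forall w, 0 <= len w <= rho ^+ size w) ->
  (forall n, \sum_(w <- words n) len w = 1) ->
  (forall th, 1 < th -> th * rho < 1 -> exists2 C, 0 <= C &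
    forall n (x y : R), 0 <= x <= 1 -> 0 <= y <= 1 -> word n x = word n y ->
      `|f x - f y| <= C * th ^+ n * len (word n x)) ->
  hausdorff_measure s (graph01 f) = 0%E.
Proof.
move=> s1 /andP[rho2 rho1] len_itv len_sum osc.
have rho0 : 0 < rho by apply: lt_le_trans rho2; rewrite invr_gt0.
have rho01 : 0 < rho < 1 by rewrite rho0.
have s0 : 0 < s := lt_trans ltr01 s1.
have sB1 : 0 < s - 1 by rewrite subr_gt0.
(* Chosen so that [- a + (1 - a) * (s - 1) = (s - 1) / 2], which makes [tau] a positive power of
   [rho]. *)
pose a := (s - 1) / (2 * s).
have a0 : 0 < a by rewrite divr_gt0 ?mulr_gt0.
have a1 : 0 < 1 - a by rewrite subr_gt0 ltr_pdivrMr ?mulr_gt0 //; lra.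
pose th := rho `^ (- a).
have th0 : 0 < th by rewrite powR_gt0.
have th1 : 1 < th.
  by rewrite /th powRN invf_gt1 ?powR_gt0 // powR_lt1.
have thrho : th * rho = rho `^ (1 - a).
  rewrite -[X in _ * X](powRr1 (ltW rho0)) -powRD; last by rewrite (gt_eqF rho0) implybT.
  by rewrite addrC.
have thrho1 : th * rho < 1 by rewrite thrho powR_lt1.
have thrho0 : 0 < th * rho by rewrite mulr_gt0.
pose tau := th * (th * rho) `^ (s - 1).
have tau01 : 0 <= tau < 1.
  rewrite mulr_ge0 ?powR_ge0 // ?(ltW th0) //=.
  rewrite /tau thrho -powRrM -powRD; last by rewrite (gt_eqF rho0) implybT.
  rewrite powR_lt1 // (_ : - a + _ = (s - 1) / 2) ?divr_gt0 //.
  by rewrite /a; field; rewrite gt_eqF.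
have [C C0 Cosc] := osc _ th1 thrho1.
apply: hausdorff_measure_eq0 => [|e e0]; first exact: ltW.
have e_th := @geometric_le (1 + C) (th * rho) e.
have e_tau := @geometric_le ((1 + C) * (1 + C) `^ (s - 1)) tau e tau01 e0.
have [n [ne1 ne2]] : exists n, (1 + C) * (th * rho) ^+ n <= e /\
    (1 + C) * (1 + C) `^ (s - 1) * tau ^+ n <= e.
  apply: (@filter_ex _ \oo); apply: filterI => //; apply: e_th => //.
  by rewrite thrho1 andbT ltW.
(* Width of the dyadic interval plus oscillation of [f] over it. *)
pose d w := 2^-1 ^+ n + C * th ^+ n * len w.
pose U w : set (R * R) := [set p | [/\ 0 <= p.1 <= 1, p.2 = f p.1 & word n p.1 = w]].
have d0 w : 0 <= d w.
  have /andP[l0 _] := len_itv w.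
  by rewrite addr_ge0 ?exprn_ge0 // !mulr_ge0 // exprn_ge0 // ltW.
have dle w : w \in words n -> d w <= (1 + C) * (th * rho) ^+ n.
  move=> /size_words wn; have /andP[l0 l1] := len_itv w.
  rewrite wn in l1; rewrite exprMn mulrDl mul1r; apply: lerD.
    apply: (@le_trans _ _ (rho ^+ n)); first by rewrite lerXn2r ?nnegrE ?invr_ge0 // ltW.
    by rewrite ler_peMl ?exprn_ge0 ?exprn_ege1 // ltW.
  by rewrite mulrA ler_wpM2l // mulr_ge0 // exprn_ge0 // ltW.
exists [seq (U w, d w) | w <- words n]; split.
- move=> _ [x x01 <-] /=; exists (U (word n x), d (word n x)).
    exact: (map_f (fun w => (U w, d w)) (mem_words n x)).
  by split=> //=; move: x01; rewrite /= in_itv.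
- move=> _ /mapP[w wn ->] /=; split; first by rewrite d0 (le_trans (dle _ wn)).
  apply: diam_le => // p q [p01 pf pw] [q01 qf qw].
  apply: (le_trans (edist_le _ _)); apply: lerD.
    by apply: word_eq_close => //; rewrite pw.
  by rewrite pf qf -pw; apply: Cosc => //; rewrite pw.
rewrite big_map /= big_seq; apply: le_trans ne2.
(* One factor of [d w ^ s] is kept for the sum and the remaining power is bounded by the largest
   diameter. *)
apply: (@le_trans _ _ (\sum_(w <- words n) d w * ((1 + C) * (th * rho) ^+ n) `^ (s - 1))).
  rewrite [leRHS]big_seq; apply: ler_sum => w wn.
  rewrite -mulr_powRB1 // ler_wpM2l //.
  by apply: ge0_ler_powR; rewrite ?nnegrE ?(ltW sB1) // ?dle // (le_trans (d0 w)) ?dle.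
have C1 : 0 <= 1 + C by rewrite addr_ge0.
have thn : 1 <= th ^+ n by rewrite exprn_ege1 // ltW.
rewrite -mulr_suml big_split /= -mulr_sumr len_sum mulr1.
(* The [2 ^ n] widths add up to 1. *)
rewrite big_const_seq count_predT count_words iter_addr_0 -[_ *+ _]mulr_natr natrX -exprMn.
rewrite mulVf ?expr1n // powRM ?exprn_ge0 // ?(ltW thrho0) //.
have -> : ((th * rho) ^+ n) `^ (s - 1) = ((th * rho) `^ (s - 1)) ^+ n.
  by rewrite -(powR_mulrn n (ltW thrho0)) powRAC powR_mulrn ?powR_ge0.
rewrite /tau exprMn.
apply: (@le_trans _ _ ((1 + C) * th ^+ n * ((1 + C) `^ (s - 1) * (th * rho) `^ (s - 1) ^+ n))).
  rewrite ler_wpM2r ?mulr_ge0 ?exprn_ge0 ?powR_ge0 //.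
  by rewrite mulrDl mul1r lerD2r.
by rewrite le_eqVlt; apply/orP; left; apply/eqP; ring.
Qed.

End UpperBound.
(** * Localization of the parameter *)

Section Localization.
Variables (R : realType) (I : set R) (openI : open I).

Lemma smooth_on_derive1 (g : R -> R) : smooth_on I g -> smooth_on I (derive1 g).
Proof. by move=> sg n t It; rewrite -derive1nSr; exact: sg. Qed.

Lemma smooth_on_affine (c d : R) (g : R -> R) :
  smooth_on I g -> smooth_on I (fun t => c + d * g t).
Proof.
move=> sg n; elim: n c g sg => [|n IH] c g sg t It.
  by apply: derivableD => //; apply: derivableM => //; exact: (sg 0%N).
(* The summand 0 keeps the derivative in affine form for the induction. *)
have E : {in I, derive1 (fun t => c + d * g t) =1 (fun t => 0 + d * derive1 g t)}.
  move=> x /[!inE] Ix; have dg := sg 0%N x Ix; rewrite derive1E.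
  have dM : is_derive x 1 (fun t => d * g t) (d * derive1 g x).
    apply: is_derive_eq; first exact: is_deriveM (is_derive_cst d x 1) (derivableP dg).
    by rewrite derive1E /GRing.scale /= mulr0 addr0.
  have [_ ->] := is_deriveD (is_derive_cst c x 1) dM.
  by rewrite derive1E.
rewrite derive1nSr.
apply: near_eq_derivable (IH 0 _ (smooth_on_derive1 sg) t It).
near=> x; apply/esym/(derive1n_eq_on openI n E); rewrite inE.
by near: x; exact: open_nbhs_nbhs.
Unshelve. all: by end_near. Qed.

Lemma smooth_on_cvg (g : R -> R) t : smooth_on I g -> I t -> g x @[x --> t] --> g t.
Proof.
move=> sg It; apply: differentiable_continuous; apply/derivable1_diffP.
exact: (sg 0%N).
Qed.

Lemma smooth_on_locally_tame (g : R -> R) t k : smooth_on I g -> I t -> 0 < g t ->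
  exists2 l, 1 <= l & \forall x \near t, forall j, (j <= k)%N ->
    `|derive1n j g x| <= l ^+ j * g x.
Proof.
move=> sg It g0.
pose B := \sum_(j < k.+1) (`|derive1n j g t| + 1).
have B0 : 0 <= B by apply: sumr_ge0 => j _; rewrite addr_ge0.
have Bj (j : 'I_k.+1) : `|derive1n j g t| + 1 <= B.
  by rewrite /B (bigD1 j) //= lerDl; apply: sumr_ge0 => i _; rewrite addr_ge0.
(* Near [t], [g] exceeds [g t / 2], so [l * g] exceeds [B], which bounds every derivative up to
   order [k]. *)
pose l := 1 + B / (g t / 2).
have l1 : 1 <= l by rewrite lerDl !divr_ge0 // ltW.
exists l => //.
have near_g : \forall x \near t, g t / 2 < g x.
  by apply: (cvgr_gt (g t) (smooth_on_cvg sg It)); rewrite ltr_pdivrMr //; lra.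
have near_d : \forall x \near t, forall j : 'I_k.+1, `|derive1n j g x| < `|derive1n j g t| + 1.
  apply: (@filter_forall _ _ (fun (j : 'I_k.+1) x =>
    `|derive1n j g x| < `|derive1n j g t| + 1) _ (nbhs_filter t)) => j.
  have cj : derive1n j g x @[x --> t] --> derive1n j g t.
    apply: differentiable_continuous; apply/derivable1_diffP; exact: sg.
  by apply: (cvgr_lt `|derive1n j g t| (cvg_norm cj)); rewrite ltrDl.
apply: filterS2 near_g near_d => x gx dx [|j] jk.
  by rewrite expr0 mul1r /= ger0_norm // ltW // (le_lt_trans _ gx) // divr_ge0 // ltW.
have gx0 : 0 < g x by rewrite (le_lt_trans _ gx) // divr_ge0 // ltW.
apply: (le_trans (ltW (dx (Ordinal (jk : (j.+1 < k.+1)%N))))).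
apply: (le_trans (Bj _)); apply: (@le_trans _ _ (l * g x)); last first.
  by rewrite ler_wpM2r ?(ltW gx0) // exprS ler_peMr ?exprn_ege1 // (le_trans ler01).
apply: (@le_trans _ _ (l * (g t / 2))); last by rewrite ler_wpM2l ?(le_trans ler01) // ltW.
rewrite /l mulrDl divfK ?mul1r ?gt_eqF ?divr_gt0 //.
by rewrite lerDr divr_ge0 // ltW.
Qed.

(** [M] exceeds the ratio required by each inequality at [t]. All of them are then strict at [t] and
    persist nearby by continuity. *)
Lemma tempered_near (b u v : R -> R) t :
  b x @[x --> t] --> b t -> u x @[x --> t] --> u t -> v x @[x --> t] --> v t ->
  0 < b t < 1 -> 0 < 1 + u t -> b t * (1 + u t) < 1 -> 0 < b t + v t ->
  exists M, \forall x \near t, tempered M (b x) (u x) (v x).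
Proof.
move=> cb cu cv /andP[b0 b1] u0 bu bv.
have b'0 : 0 < 1 - b t by rewrite subr_gt0.
have v0 : 0 < 1 + v t by lra.
have ub0 : 0 < (1 + u t) * (1 - b t) by rewrite mulr_gt0.
have bu0 : 0 < 1 - b t * (1 + u t) by rewrite subr_gt0.
pose m1 := (1 - b t)^-1; pose m2 := ((1 + u t) * (1 - b t))^-1.
pose m3 := (1 + u t) * (1 - b t) / (1 - b t * (1 + u t)).
pose m4 := (1 + v t) / b t; pose m5 := b t / (b t + v t).
have m1_gt0 : 0 < m1 by rewrite invr_gt0.
have m2_gt0 : 0 < m2 by rewrite invr_gt0.
have m3_gt0 : 0 < m3 by rewrite divr_gt0.
have m4_gt0 : 0 < m4 by rewrite divr_gt0.
have m5_gt0 : 0 < m5 by rewrite divr_gt0.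
pose M := 1 + m1 + m2 + m3 + m4 + m5.
have h1 : 0 < M * (1 - b t) - 1.
  by rewrite subr_gt0 -ltr_pdivrMr // div1r -/m1 /M; lra.
have h2 : 0 < M * ((1 + u t) * (1 - b t)) - 1.
  by rewrite subr_gt0 -ltr_pdivrMr // div1r -/m2 /M; lra.
have h3 : 0 < M * (1 - b t * (1 + u t)) - (1 + u t) * (1 - b t).
  by rewrite subr_gt0 -ltr_pdivrMr // -/m3 /M; lra.
have h4 : 0 < M * b t - (1 + v t).
  by rewrite subr_gt0 -ltr_pdivrMr // -/m4 /M; lra.
have h5 : 0 < M * (b t + v t) - b t.
  by rewrite subr_gt0 -ltr_pdivrMr // -/m5 /M; lra.
have M1 : 1 <= M by rewrite /M; lra.
clearbody M; exists M.
have pos (h : R -> R) : h x @[x --> t] --> h t -> 0 < h t -> \forall x \near t, 0 < h x.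
  by move=> ch h0; apply: (cvgr_gt (h t) ch).
have c1 : 1 - b x @[x --> t] --> 1 - b t by apply: cvgB => //; exact: cvg_cst.
have cu1 : 1 + u x @[x --> t] --> 1 + u t by apply: cvgD => //; exact: cvg_cst.
have cv1 : 1 + v x @[x --> t] --> 1 + v t by apply: cvgD => //; exact: cvg_cst.
have cM : (fun=> M) x @[x --> t] --> M by exact: cvg_cst.
have cone : (fun=> 1 : R) x @[x --> t] --> (1 : R) by exact: cvg_cst.
have n1 : \forall x \near t, 0 < M * (1 - b x) - 1.
  by apply: (pos (fun x => M * (1 - b x) - 1)) => //; apply: cvgB => //; apply: cvgM.
have n2 : \forall x \near t, 0 < M * ((1 + u x) * (1 - b x)) - 1.
  apply: (pos (fun x => M * ((1 + u x) * (1 - b x)) - 1)) => //.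
  by apply: cvgB => //; apply: cvgM => //; apply: cvgM.
have n3 : \forall x \near t, 0 < M * (1 - b x * (1 + u x)) - (1 + u x) * (1 - b x).
  apply: (pos (fun x => M * (1 - b x * (1 + u x)) - (1 + u x) * (1 - b x))) => //.
  by apply: cvgB; apply: cvgM => //; apply: cvgB => //; apply: cvgM.
have n4 : \forall x \near t, 0 < M * b x - (1 + v x).
  by apply: (pos (fun x => M * b x - (1 + v x))) => //; apply: cvgB => //; apply: cvgM.
have n5 : \forall x \near t, 0 < M * (b x + v x) - b x.
  apply: (pos (fun x => M * (b x + v x) - b x)) => //.
  by apply: cvgB => //; apply: cvgM => //; apply: cvgD.
have n6 : \forall x \near t, 0 < b x by exact: pos.
have n7 : \forall x \near t, 0 < 1 - b x by exact: (pos (fun x => 1 - b x)).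
have n8 : \forall x \near t, 0 < 1 + u x by exact: (pos (fun x => 1 + u x)).
have n9 : \forall x \near t, 0 < 1 + v x by exact: (pos (fun x => 1 + v x)).
near=> x.
have g1 : 0 < M * (1 - b x) - 1 by near: x.
have g2 : 0 < M * ((1 + u x) * (1 - b x)) - 1 by near: x.
have g3 : 0 < M * (1 - b x * (1 + u x)) - (1 + u x) * (1 - b x) by near: x.
have g4 : 0 < M * b x - (1 + v x) by near: x.
have g5 : 0 < M * (b x + v x) - b x by near: x.
have g6 : 0 < b x by near: x.
have g7 : 0 < 1 - b x by near: x.
have g8 : 0 < 1 + u x by near: x.
have g9 : 0 < 1 + v x by near: x.
by split=> //; lra.
Unshelve. all: by end_near. Qed.

End Localization.

(** * Choice of a parameter neighbourhood of 0 and conclusion *)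

Theorem theorem3p1 (R : realType) (I : set R) (b1 c0 c1 : R -> R)
    (F : R -> R -> R)
    (I_open : open I) (I_itv : is_interval I) (I0 : I 0)
    (b1_smooth : smooth_on I b1) (c0_smooth : smooth_on I c0)
    (c1_smooth : smooth_on I c1)
    (curve_in : forall t, I t -> param_region (b1 t, c0 t, c1 t))
    (F_sol : forall t, I t ->
       deRham_solution (matA0 (b1 t) (c0 t)) (matA1 (b1 t) (c1 t)) (F t))
    (k : nat) (k_ge1 : (1 <= k)%N) :
  hausdorff_dim (graph01 (fun x => derive1n k (fun t => F t x) 0)) = 1%E.
Proof.
apply: hausdorff_dim_graph_eq1 => s s1.
have [b01 /andP[u0 u1] /andP[v0 v1] _] := curve_in 0 I0.
have /andP[b0 b1'] := b01.
have u0' : 0 < 1 + c0 0 by lra.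
have v0' : 0 < 1 + c1 0 by lra.
have bu : b1 0 * (1 + c0 0) < 1 by rewrite mulrC -ltr_pdivlMr //; lra.
have bv : 0 < b1 0 + c1 0 by lra.
have [M nM] := tempered_near (smooth_on_cvg b1_smooth I0) (smooth_on_cvg c0_smooth I0)
  (smooth_on_cvg c1_smooth I0) b01 u0' bu bv.
have sb' : smooth_on I (fun t => 1 - b1 t).
  have := @smooth_on_affine _ _ I_open 1 (-1) _ b1_smooth.
  by congr (smooth_on I _); apply/funext => t; rewrite mulN1r.
have su : smooth_on I (fun t => 1 + c0 t).
  have := @smooth_on_affine _ _ I_open 1 1 _ c0_smooth.
  by congr (smooth_on I _); apply/funext => t; rewrite mul1r.
have sv : smooth_on I (fun t => 1 + c1 t).
  have := @smooth_on_affine _ _ I_open 1 1 _ c1_smooth.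
  by congr (smooth_on I _); apply/funext => t; rewrite mul1r.
have b1'' : 0 < 1 - b1 0 by rewrite subr_gt0.
have [l1 l1_ge1 n1] := @smooth_on_locally_tame _ I _ 0 k b1_smooth I0 b0.
have [l2 l2_ge1 n2] := @smooth_on_locally_tame _ I _ 0 k sb' I0 b1''.
have [l3 l3_ge1 n3] := @smooth_on_locally_tame _ I _ 0 k su I0 u0'.
have [l4 l4_ge1 n4] := @smooth_on_locally_tame _ I _ 0 k sv I0 v0'.
have nI : \forall t \near 0, I t by exact: open_nbhs_nbhs.
pose derive_bound l (g : R -> R) t :=
  forall j, (j <= k)%N -> `|derive1n j g t| <= l ^+ j * g t.
pose good t := [/\ I t, tempered M (b1 t) (c0 t) (c1 t), derive_bound l1 b1 t,
  derive_bound l2 (fun t => 1 - b1 t) t &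
  derive_bound l3 (fun t => 1 + c0 t) t /\ derive_bound l4 (fun t => 1 + c1 t) t].
have good0 : \forall t \near 0, good t.
  by near=> t; split; [| | | |split]; near: t.
(* Taking the interior turns finitely many conditions valid near 0 into conditions on one open
   set. *)
pose V := interior [set t | good t].
have openV : open V by exact: open_interior.
have V0 : V 0 by [].
have Vgood t : V t -> good t by move=> /interior_subset.
have VI t : V t -> I t by move=> /Vgood[].
have VM t : V t -> tempered M (b1 t) (c0 t) (c1 t) by move=> /Vgood[].
pose l := l1 + l2 + l3 + l4.
have l_ge1 : 1 <= l by rewrite /l; lra.
have tameV (g : R -> R) m : smooth_on I g -> 1 <= m <= l -> (forall t, V t -> 0 < g t) ->
    (forall t, V t -> forall j, (j <= k)%N -> `|derive1n j g t| <= m ^+ j * g t) ->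
    tame V k l g g.
  move=> sg /andP[m1 ml] g0 gb.
  apply: (@tame_le _ _ _ m _ _ g) => //; first by rewrite (le_trans ler01).
  apply: derive1n_tame => // t j Vt jk; last exact: gb.
  exact/sg/VI.
have tb : tame V k l b1 b1.
  apply: (tameV _ l1) => // [|t /VM[/andP[]] //|t /Vgood[] //].
  by rewrite l1_ge1 /l; lra.
have tb' : tame V k l (fun t => 1 - b1 t) (fun t => 1 - b1 t).
  apply: (tameV _ l2) => // [|t /VM[/andP[]]|t /Vgood[] //].
    by rewrite l2_ge1 /l; lra.
  by rewrite subr_gt0.
have tu : tame V k l (fun t => 1 + c0 t) (fun t => 1 + c0 t).
  apply: (tameV _ l3) => // [|t /VM[] //|t /Vgood[_ _ _ _ []] //].
  by rewrite l3_ge1 /l; lra.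
have tv : tame V k l (fun t => 1 + c1 t) (fun t => 1 + c1 t).
  apply: (tameV _ l4) => // [|t /VM[] //|t /Vgood[_ _ _ _ []] //].
  by rewrite l4_ge1 /l; lra.
have T0 := VM _ V0; have [_ _ _ M1 _ _ _ _ _] := T0.
(* The weights are the interval lengths at the parameter 0. *)
apply: (@hausdorff_measure_graph_words _ _ _ (contraction M) (wlen (b1 0) (c0 0) (c1 0))) => //.
- exact: contraction_itv.
- by move=> w; rewrite (wlen_le T0) andbT; exact/ltW/(wlen_gt0 T0).
- exact: sum_wlen T0.
move=> th th1 thM.
have F_solV t : V t -> deRham_solution (matA0 (b1 t) (c0 t)) (matA1 (b1 t) (c1 t)) (F t).
  by move=> /VI; exact: F_sol.
have [C C0 HC] := derive1n_oscillation openV VM l_ge1 tb tb' tu tv F_solV th1 thM.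
by exists C => // n x y x01 y01 wxy; exact: HC.
Unshelve. all: by end_near. Qed.
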